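(* Let $r>0$, let $Q\in\mathbb{R}^{n\times n}$ be symmetric positive definite, and let $\gamma\in(0,2)$. Let $\{\mathbf{w}^k\}_{k\ge 0}$, $\mathbf{w}^k=(\mathbf{x}^k;\lambda^k)$, be the sequence generated by P-rALM from an arbitrary starting point $\mathbf{w}^0=(\mathbf{x}^0;\lambda^0)\in\mathbb{R}^n\times\mathbb{R}^m$. Then for all $k\ge 0$ and all $\mathbf{w}^*\in\mathcal{M}^*$, $$\|\mathbf{w}^{k+1}-\mathbf{w}^*\|_H^2\le \|\mathbf{w}^k-\mathbf{w}^*\|_H^2-\frac{2-\gamma}{\gamma}\,\|\mathbf{w}^k-\mathbf{w}^{k+1}\|_H^2 .$$ Moreover, there exists a point $\mathbf{w}^\infty\in\mathcal{M}^*$ such that $\lim_{k\to\infty}\mathbf{w}^k=\mathbf{w}^\infty$.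
   Context: Problem: $\min\{\theta(\mathbf{x})\mid A\mathbf{x}=b \text{ (or } A\mathbf{x}\ge b),\ \mathbf{x}\in\mathcal{X}\}$, where $\theta:\mathbb{R}^n\to\mathbb{R}$ is a closed proper convex function, $\mathcal{X}\subseteq\mathbb{R}^n$ is a nonempty closed convex set, $A\in\mathbb{R}^{m\times n}$, $b\in\mathbb{R}^m$. Put $\Lambda=\mathbb{R}^m$ in the case of the equality constraint $A\mathbf{x}=b$, and $\Lambda=\mathbb{R}^m_+$ (nonnegative vectors) in the case of the inequality constraint $A\mathbf{x}\ge b$. Let $\mathcal{P}_\Lambda$ be the Euclidean projection onto $\Lambda$, and $\mathcal{M}=\mathcal{X}\times\Lambda$. For $\mathbf{w}=(\mathbf{x};\lambda)$ let $\mathcal{J}(\mathbf{w})=\begin{pmatrix}-A^{T}\lambda\\ A\mathbf{x}-b\end{pmatrix}$. The set $\mathcal{M}^*$ consists of all $\mathbf{w}^*=(\mathbf{x}^*;\lambda^* )\in\mathcal{M}$ with $$\theta(\mathbf{x})-\theta(\mathbf{x}^* )+\langle\mathbf{w}-\mathbf{w}^*,\mathcal{J}(\mathbf{w}^* )\rangle\ge 0\quad\text{for all }\mathbf{w}=(\mathbf{x};\lambda)\in\mathcal{M}$$ (equivalently, the saddle points of $L(\mathbf{x},\lambda)=\theta(\mathbf{x})-\langle\lambda,A\mathbf{x}-b\rangle$ on $\mathcal{X}\times\Lambda$). Standing assumption: $\mathcal{M}^*\neq\emptyset$. P-rALM with parameters $\gamma\in(0,2)$, $r>0$, $Q\succ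 0$: for $k=0,1,2,\dots$, $$\widetilde{\mathbf{x}}^k=\arg\min_{\mathbf{x}\in\mathcal{X}}\ \theta(\mathbf{x})-\langle\lambda^k,A\mathbf{x}-b\rangle+\tfrac r2\|A(\mathbf{x}-\mathbf{x}^k)\|^2+\tfrac12\|\mathbf{x}-\mathbf{x}^k\|_Q^2,$$ $$\widetilde{\lambda}^k=\mathcal{P}_\Lambda\big(\lambda^k-r[A(2\widetilde{\mathbf{x}}^k-\mathbf{x}^k)-b]\big),$$ $$\mathbf{x}^{k+1}=\mathbf{x}^k+\gamma(\widetilde{\mathbf{x}}^k-\mathbf{x}^k),\qquad \lambda^{k+1}=\lambda^k+\gamma(\widetilde{\lambda}^k-\lambda^k).$$ Here $\|\cdot\|$ is the Euclidean norm, $\|\mathbf{w}\|_H=\sqrt{\langle\mathbf{w},H\mathbf{w}\rangle}$ for symmetric positive definite $H$, and $$H=\begin{bmatrix} rA^{T}A+Q & A^{T}\\ A & \frac1r\mathbf{I}\end{bmatrix},$$ which is symmetric positive definite. *)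

(* Defs.v *)
From mathcomp Require Import all_boot all_order all_algebra.
From mathcomp Require Import all_classical all_reals all_analysis.

Set Implicit Arguments.
Unset Strict Implicit.
Unset Printing Implicit Defensive.

Import Order.TTheory GRing.Theory Num.Theory.
Import numFieldNormedType.Exports.

Local Open Scope classical_set_scope.
Local Open Scope ring_scope.

(* The library norm on matrices is the sup norm, hence the explicit Euclidean
   structure below; the topology on matrices is the usual one. *)
Definition dot (R : realType) (d : nat) (u v : 'cV[R]_d) : R :=
  \sum_(i < d) u i 0 * v i 0.

Definition enorm (R : realType) (d : nat) (u : 'cV[R]_d) : R :=
  Num.sqrt (dot u u).

Definition norm_in (R : realType) (d : nat) (H : 'M[R]_d) (u : 'cV[R]_d) : R :=
  Num.sqrt (dot u (H *m u)).

Definition posdef (R : realType) (d : nat) (Q : 'M[R]_d) : Prop :=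
  Q^T = Q /\ forall u : 'cV[R]_d, u != 0 -> 0 < dot u (Q *m u).

Definition is_argmin (R : realType) (T : Type) (D : set T) (f : T -> R) (x : T)
    : Prop :=
  D x /\ forall y, D y -> f x <= f y.

Definition is_projection (R : realType) (d : nat) (S : set 'cV[R]_d)
    (u p : 'cV[R]_d) : Prop :=
  is_argmin S (fun v => enorm (v - u)) p.

(* A x = b, resp. A x >= b componentwise *)
Variant constraint := EqConstraint | GeConstraint.

Definition multipliers (R : realType) (m : nat) (c : constraint)
    : set 'cV[R]_m :=
  match c with
  | EqConstraint => setT
  | GeConstraint => [set l | forall i, 0 <= l i 0]
  end.

(* A point w = (x; l) is stored as the stacked column col_mx x l, so that
   x = usubmx w and l = dsubmx w. *)
Definition primal_dual (R : realType) (m n : nat) (X : set 'cV[R]_n)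
    (c : constraint) : set 'cV[R]_(n + m) :=
  [set w | X (usubmx w) /\ multipliers c (dsubmx w)].

Definition Jop (R : realType) (m n : nat) (A : 'M[R]_(m, n)) (b : 'cV[R]_m)
    (w : 'cV[R]_(n + m)) : 'cV[R]_(n + m) :=
  col_mx (- (A^T *m dsubmx w)) (A *m usubmx w - b).

Definition solutions (R : realType) (m n : nat) (theta : 'cV[R]_n -> R)
    (X : set 'cV[R]_n) (c : constraint) (A : 'M[R]_(m, n)) (b : 'cV[R]_m)
    : set 'cV[R]_(n + m) :=
  [set ws | primal_dual X c ws /\
    forall w, primal_dual X c w ->
      0 <= theta (usubmx w) - theta (usubmx ws) + dot (w - ws) (Jop A b ws)].

Definition Hmat (R : realType) (m n : nat) (A : 'M[R]_(m, n)) (r : R)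
    (Q : 'M[R]_n) : 'M[R]_(n + m) :=
  block_mx (r *: (A^T *m A) + Q) A^T A (r^-1)%:M.

Definition subproblem (R : realType) (m n : nat) (theta : 'cV[R]_n -> R)
    (A : 'M[R]_(m, n)) (b : 'cV[R]_m) (r : R) (Q : 'M[R]_n)
    (xk : 'cV[R]_n) (lk : 'cV[R]_m) (x : 'cV[R]_n) : R :=
  theta x - dot lk (A *m x - b) + r / 2 * enorm (A *m (x - xk)) ^+ 2
  + 2^-1 * norm_in Q (x - xk) ^+ 2.

Definition P_rALM (R : realType) (m n : nat) (theta : 'cV[R]_n -> R)
    (X : set 'cV[R]_n) (c : constraint) (A : 'M[R]_(m, n)) (b : 'cV[R]_m)
    (gamma r : R) (Q : 'M[R]_n)
    (x : nat -> 'cV[R]_n) (l : nat -> 'cV[R]_m) : Prop :=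
  forall k : nat, exists (xt : 'cV[R]_n) (lt : 'cV[R]_m),
    [/\ is_argmin X (subproblem theta A b r Q (x k) (l k)) xt,
        is_projection (multipliers c)
          (l k - r *: (A *m (2 *: xt - x k) - b)) lt,
        x k.+1 = x k + gamma *: (xt - x k) &
        l k.+1 = l k + gamma *: (lt - l k)].

(* Main.v *)
(* Comparing the optimality conditions of the two subproblems shows that the
   predictor wt = (xt; lt) satisfies, for every feasible w,
     theta x - theta xt + <w - wt, J w + H (wt - wk)> >= 0,
   the matrix H being exactly the one that collects all the proximal terms. As
   J is affine with a skew linear part, taking w = ws makes the J-terms cancel
   against the inequality defining ws, which leaves <ws - wt, H (wt - wk)> >= 0;
   expanding the relaxation step wk + gamma (wt - wk) gives the contraction.
   Hence the steps tend to 0, the inequality above passes to the limit at any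
   cluster point by lower semicontinuity of theta, and the sequence converges
   by Opial's argument: its distance to a cluster point is nonincreasing. *)
Require Import Defs.
From mathcomp Require Import all_boot all_order all_algebra.
From mathcomp Require Import all_classical all_reals all_analysis.
From mathcomp Require Import ring lra.

Set Implicit Arguments.
Unset Strict Implicit.
Unset Printing Implicit Defensive.

Import Order.TTheory GRing.Theory Num.Theory.
Import numFieldNormedType.Exports.

Local Open Scope classical_set_scope.
Local Open Scope ring_scope.

(** * Bilinear algebra of the Euclidean inner product *)

Section Dot.
Context {R : realType}.
Implicit Types d : nat.

Lemma dotC d (u v : 'cV[R]_d) : dot u v = dot v u.
Proof. by apply: eq_bigr => i _; rewrite mulrC. Qed.

Lemma dotDr d (u v w : 'cV[R]_d) : dot u (v + w) = dot u v + dot u w.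
Proof. by rewrite -big_split; apply: eq_bigr => i _; rewrite mxE mulrDr. Qed.

Lemma dotDl d (u v w : 'cV[R]_d) : dot (u + v) w = dot u w + dot v w.
Proof. by rewrite dotC dotDr !(dotC w). Qed.

Lemma dotZr d a (u v : 'cV[R]_d) : dot u (a *: v) = a * dot u v.
Proof. by rewrite mulr_sumr; apply: eq_bigr => i _; rewrite mxE mulrCA. Qed.

Lemma dotZl d a (u v : 'cV[R]_d) : dot (a *: u) v = a * dot u v.
Proof. by rewrite dotC dotZr dotC. Qed.

Lemma dotNr d (u v : 'cV[R]_d) : dot u (- v) = - dot u v.
Proof. by rewrite -scaleN1r dotZr mulN1r. Qed.

Lemma dotNl d (u v : 'cV[R]_d) : dot (- u) v = - dot u v.
Proof. by rewrite dotC dotNr dotC. Qed.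

Lemma dot0r d (u : 'cV[R]_d) : dot u 0 = 0.
Proof. by rewrite -(scale0r 0) dotZr mul0r. Qed.

Lemma dot_mulmxr m n (M : 'M[R]_(m, n)) u v : dot u (M *m v) = dot (M^T *m u) v.
Proof.
transitivity ((u^T *m (M *m v)) 0 0).
  by rewrite [RHS]mxE; apply: eq_bigr => i _; rewrite [u^T 0 i]mxE.
rewrite mulmxA -[u^T *m M]trmxK trmx_mul trmxK mxE.
by apply: eq_bigr => i _; rewrite mxE.
Qed.

Lemma dot_col_mx m n (a c : 'cV[R]_m) (b e : 'cV[R]_n) :
  dot (col_mx a b) (col_mx c e) = dot a c + dot b e.
Proof.
rewrite /dot big_split_ord; congr (_ + _).
  by apply: eq_bigr => i _; rewrite !col_mxEu.
by apply: eq_bigr => i _; rewrite !col_mxEd.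
Qed.

Lemma dot_ge0 d (u : 'cV[R]_d) : 0 <= dot u u.
Proof. by apply: sumr_ge0 => i _; rewrite -expr2 sqr_ge0. Qed.

Lemma dot_gt0 d (u : 'cV[R]_d) : u != 0 -> 0 < dot u u.
Proof.
move=> u0; rewrite lt_neqAle dot_ge0 andbT eq_sym; apply: contra u0 => /eqP uu0.
apply/eqP/colP => i; rewrite mxE; apply/eqP; rewrite -sqrf_eq0 expr2.
have := @psumr_eq0P R 'I_d predT (fun i => u i 0 * u i 0).
by move=> -> // j _; rewrite -expr2 sqr_ge0.
Qed.

Lemma dot_delta d (u : 'cV[R]_d) i : dot (delta_mx i 0) u = u i 0.
Proof.
rewrite /dot (bigD1 i) //= big1 ?addr0 ?mxE ?eqxx ?mul1r // => j ji.
by rewrite mxE (negPf ji) mul0r.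
Qed.

Lemma enorm_sqr d (u : 'cV[R]_d) : enorm u ^+ 2 = dot u u.
Proof. by rewrite sqr_sqrtr // dot_ge0. Qed.

(** * Quadratic forms of positive definite matrices *)

Section PositiveDefinite.
Context {d : nat} {H : 'M[R]_d}.
Hypothesis Hpos : posdef H.

Lemma posdefC u v : dot u (H *m v) = dot v (H *m u).
Proof. by rewrite dot_mulmxr Hpos.1 dotC. Qed.

Lemma posdef_ge0 u : 0 <= dot u (H *m u).
Proof.
have [->|u0] := eqVneq u 0; first by rewrite mulmx0 dot0r.
exact/ltW/Hpos.2.
Qed.

Lemma norm_in_sqr u : norm_in H u ^+ 2 = dot u (H *m u).
Proof. by rewrite sqr_sqrtr // posdef_ge0. Qed.

(** By symmetry of [H], a row of the left kernel becomes, once transposed, a vector killed by [H];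
    the form vanishes there, so the vector is 0. *)
Lemma posdef_unitmx : H \in unitmx.
Proof.
rewrite -row_free_unit -kermx_eq0; apply/eqP/row_matrixP => i; rewrite row0.
have Hk0 : H *m (row i (kermx H))^T = 0.
  by rewrite -[H in H *m _]Hpos.1 -trmx_mul -row_mul mulmx_ker row0 trmx0.
apply: trmx_inj; rewrite trmx0; apply/eqP/negPn/negP => /(Hpos.2 _).
by rewrite Hk0 dot0r ltxx.
Qed.

(** With a = <u, H u>, c = <u, H v> and e = <v, H v>, the form at a v - c u equals a (a e - c^2);
    for u nonzero, a > 0 can be divided out. *)
Lemma posdef_CauchySchwarz u v :
  dot u (H *m v) ^+ 2 <= dot u (H *m u) * dot v (H *m v).
Proof.
set a := dot u (H *m u); set c := dot u (H *m v); set e := dot v (H *m v).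
have [u0|u0] := eqVneq u 0.
  by rewrite /a /c u0 dotC dot0r expr0n /= mulr_ge0 // ?posdef_ge0 //.
have a_gt0 : 0 < a by exact: Hpos.2.
have := posdef_ge0 (a *: v - c *: u).
rewrite !mulmxBr -!scalemxAr !(dotDl, dotDr, dotNl, dotNr, dotZl, dotZr).
rewrite (posdefC v u) -/a -/c -/e => h.
have : 0 <= a * (a * e - c ^+ 2) by move: h; lra.
by rewrite pmulr_rge0 // subr_ge0.
Qed.

(* [u i 0 = <H^-1 e_i, H u>] *)
Lemma posdef_coord_le :
  exists2 C : R, 0 < C &
    forall (u : 'cV[R]_d) i, u i 0 ^+ 2 <= C * dot u (H *m u).
Proof.
pose f i : 'cV[R]_d := invmx H *m delta_mx i 0.
have f_ge0 i : 0 <= dot (f i) (H *m f i) by exact: posdef_ge0.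
(* The sum dominates the Cauchy-Schwarz factor of every coordinate at once; the 1 keeps the constant
   positive even when d = 0. *)
exists (1 + \sum_i dot (f i) (H *m f i)).
  by rewrite ltr_pwDl // sumr_ge0.
move=> u i; have -> : u i 0 = dot u (H *m f i).
  by rewrite mulKVmx ?posdef_unitmx // dotC dot_delta.
apply: le_trans (posdef_CauchySchwarz _ _) _.
rewrite mulrC ler_wpM2r ?posdef_ge0 // (bigD1 i) //= addrCA lerDl.
by rewrite addr_ge0 // sumr_ge0.
Qed.

End PositiveDefinite.
End Dot.

(** Completing the square: <w, H w> = <x, Q x> + r |A x + l / r|^2. If x = 0, the second term is
    positive because l is then nonzero. *)
Lemma posdef_Hmat (R : realType) (m n : nat) (A : 'M[R]_(m, n)) (r : R)
    (Q : 'M[R]_n) : 0 < r -> posdef Q -> posdef (Hmat A r Q).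
Proof.
move=> r_gt0 Qpos; split.
  rewrite /Hmat tr_block_mx trmxK tr_scalar_mx; congr block_mx.
  by rewrite linearD linearZ /= trmx_mul trmxK Qpos.1.
move=> w; rewrite -[w]vsubmxK; set x := usubmx w; set l := dsubmx w => w0.
rewrite /Hmat mul_block_col dot_col_mx !mulmxDl -!scalemxAl -mulmxA.
rewrite mul_scalar_mx !(dotDr, dotZr) !(dot_mulmxr A^T) trmxK.
set ax := A *m x; have -> :
    r * dot ax ax + dot x (Q *m x) + dot ax l + (dot l ax + r^-1 * dot l l) =
    dot x (Q *m x) + r * dot (ax + r^-1 *: l) (ax + r^-1 *: l).
  rewrite !(dotDl, dotDr, dotZl, dotZr) (dotC l ax); field; exact: lt0r_neq0.
have [x0|x0] := eqVneq x 0; last first.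
  by rewrite ltr_pwDl ?Qpos.2 // mulr_ge0 ?dot_ge0 // ltW.
have l0 : l != 0 by apply: contra_neq w0 => ->; rewrite x0 col_mx0.
rewrite /ax x0 !mulmx0 dot0r !add0r mulr_gt0 // dot_gt0 // scaler_eq0.
by rewrite (negPf l0) orbF invr_eq0 lt0r_neq0.
Qed.

(** * Optimality conditions of the two subproblems and of the predictor *)

Section VariationalInequality.
Context {R : realType}.

Lemma small_slope_ge0 (a s : R) :
  (forall t, 0 < t -> t <= 1 -> 0 <= t * a + t ^+ 2 * s) -> 0 <= a.
Proof.
move=> h; rewrite leNgt; apply/negP => a_lt0.
have den_gt0 : 0 < `|s| - a by rewrite ltr_wpDl // oppr_gt0.
have den2_gt0 : 0 < 2 * (`|s| - a) by rewrite mulr_gt0.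
(* Chosen so that t (|s| - a) = - a / 2, which makes the quadratic term too small to compensate a
   negative slope. *)
pose t := - a / (2 * (`|s| - a)).
have t_gt0 : 0 < t by rewrite divr_gt0 // oppr_gt0.
have t_le1 : t <= 1.
  by rewrite ler_pdivrMr // mul1r; have := normr_ge0 s; lra.
have : 0 <= t * (a + t * s).
  by have := h t t_gt0 t_le1; rewrite mulrDr mulrA -expr2.
rewrite pmulr_rge0 // leNgt => /negP; apply.
suff : t * s < - a by lra.
have ts : t * s <= t * (`|s| - a).
  by rewrite ler_pM2l //; have := ler_norm s; lra.
apply: le_lt_trans ts _; rewrite /t invfM mulrA mulfVK ?lt0r_neq0 //; lra.
Qed.

(** Minimality is tested at z + t (y - z). Convexity bounds the increase of [h] by t (h y - h z),
    and the exact expansion of [p] has slope [g]; [small_slope_ge0] then lets t tend to 0. Only [p]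
    is differentiated, so [h] may be nonsmooth. *)
Lemma argmin_variational (d : nat) (D : set 'cV[R]_d) (h p : 'cV[R]_d -> R)
    (z y : 'cV[R]_d) (g s : R) :
  convex_set D -> convex_function setT h ->
  is_argmin D (fun v => h v + p v) z -> D y ->
  (forall t, p (z + t *: (y - z)) = p z + t * g + t ^+ 2 * s) ->
  0 <= h y - h z + g.
Proof.
move=> Dconv hconv [Dz zmin] Dy pE; apply: (@small_slope_ge0 _ s) => t t0 t1.
pose T : {i01 R} := Itv01 (ltW t0) t1.
have convE : conv T (y : convex_lmodType 'cV[R]_d) z = z + t *: (y - z).
  rewrite /conv /= /unstable.onem scalerBr scalerBl scale1r addrC -!addrA.
  by congr (_ + _); rewrite addrC.
have := Dconv y z T; rewrite !inE convE => /(_ Dy Dz) Dt.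
have := hconv T y z; rewrite !inE convE => /(_ I I).
rewrite convRE /= /unstable.onem => ht.
have := zmin _ Dt; rewrite pE; move: ht.
set ht := h (_ + _); lra.
Qed.

(** The case h = 0 of [argmin_variational], with p the squared distance to [u], which has the same
    minimizers as the distance. *)
Lemma projection_variational (d : nat) (S : set 'cV[R]_d) (u z y : 'cV[R]_d) :
  convex_set S -> is_projection S u z -> S y -> 0 <= dot (y - z) (z - u).
Proof.
move=> Sconv [Sz zmin] Sy.
suff : 0 <= 0 - 0 + 2 * dot (y - z) (z - u).
  by rewrite subrr add0r pmulr_rge0.
apply: (@argmin_variational d S (fun=> 0) (fun v => dot (v - u) (v - u))
  z y _ (dot (y - z) (y - z)) Sconv) Sy _ => [t v w _ _||t].
- by rewrite convRE !mulr0 addr0.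
- split=> // v Sv; rewrite !add0r -!enorm_sqr lerXn2r ?nnegrE ?sqrtr_ge0 //.
  exact: zmin.
- rewrite addrAC !(dotDl (z - u), dotDr _ (z - u), dotZl, dotZr).
  rewrite (dotC (z - u)); ring.
Qed.

Lemma convex_multipliers (m : nat) (c : constraint) :
  convex_set (multipliers c : set 'cV[R]_m).
Proof.
case: c => u v t; rewrite !inE /=; first by [].
move=> u0 v0 i; rewrite !mxE.
by rewrite addr_ge0 // mulr_ge0 // subr_ge0.
Qed.

Context (m n : nat) (theta : 'cV[R]_n -> R) (X : set 'cV[R]_n) (c : constraint).
Context (A : 'M[R]_(m, n)) (b : 'cV[R]_m) (r : R) (Q : 'M[R]_n).
Hypotheses (theta_convex : convex_function setT theta).
Hypotheses (X_convex : convex_set X).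
Hypotheses (r_gt0 : 0 < r) (Q_posdef : posdef Q).

Lemma subproblem_variational (xk xt y : 'cV[R]_n) (lk : 'cV[R]_m) :
  is_argmin X (subproblem theta A b r Q xk lk) xt -> X y ->
  0 <= theta y - theta xt + (- dot lk (A *m (y - xt))
    + r * dot (A *m (y - xt)) (A *m (xt - xk)) + dot (y - xt) (Q *m (xt - xk))).
Proof.
move=> xt_min Xy.
pose p v := - dot lk (A *m v - b) + r / 2 * enorm (A *m (v - xk)) ^+ 2
  + 2^-1 * norm_in Q (v - xk) ^+ 2.
apply: (@argmin_variational n X theta p xt y _
  (r / 2 * dot (A *m (y - xt)) (A *m (y - xt))
   + 2^-1 * dot (y - xt) (Q *m (y - xt))) X_convex theta_convex) Xy _ => [|t].
  by split=> [|v Xv]; [exact: xt_min.1 | rewrite !addrA; exact: xt_min.2].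
rewrite /p !enorm_sqr !(norm_in_sqr Q_posdef).
rewrite (addrAC xt _ (- xk)); move: (y - xt) (xt - xk) => e f.
rewrite !mulmxDr -!scalemxAr (addrAC (A *m xt)).
move: (A *m xt - b) (A *m e) (A *m f) => ax ae af.
rewrite !(dotDl, dotDr, dotZl, dotZr) (posdefC Q_posdef f e) (dotC af ae).
by field.
Qed.

(** The linear part of J is skew, so <w - w', J w - J w'> = 0 and J may be evaluated at either
    end. *)
Lemma Jop_skew (w w' : 'cV[R]_(n + m)) :
  dot (w - w') (Jop A b w) = dot (w - w') (Jop A b w').
Proof.
rewrite -[w]vsubmxK -[w']vsubmxK /Jop opp_col_mx add_col_mx !col_mxKu !col_mxKd.
rewrite !dot_col_mx !dotNr !(dot_mulmxr A^T) trmxK !mulmxDr mulmxN.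
set a := A *m usubmx w; set a' := A *m usubmx w'.
rewrite !(dotDl, dotDr, dotNl, dotNr).
rewrite !(dotC (dsubmx _) a) !(dotC (dsubmx _) a').
ring.
Qed.

Lemma prediction_variational (xk xt : 'cV[R]_n) (lk lt : 'cV[R]_m)
    (w : 'cV[R]_(n + m)) :
  is_argmin X (subproblem theta A b r Q xk lk) xt ->
  is_projection (multipliers c) (lk - r *: (A *m (2 *: xt - xk) - b)) lt ->
  primal_dual X c w ->
  0 <= theta (usubmx w) - theta xt
    + dot (w - col_mx xt lt) (Jop A b w)
    + dot (w - col_mx xt lt) (Hmat A r Q *m (col_mx xt lt - col_mx xk lk)).
Proof.
move=> xt_min lt_proj; rewrite -[w]vsubmxK.
set y := usubmx w; set l := dsubmx w => -[].
rewrite /= col_mxKu col_mxKd => Xy ly.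
have x_vi := subproblem_variational xt_min Xy.
(* The factor 1/r turns the multiplier residual into A (2 xt - xk) - b + (lt - lk) / r, the scale of
   the second block row of [Hmat]. *)
have l_vi : 0 <=
    r^-1 * dot (l - lt) (lt - (lk - r *: (A *m (2 *: xt - xk) - b))).
  rewrite mulr_ge0 ?invr_ge0 ?(ltW r_gt0) //.
  exact: projection_variational (@convex_multipliers m c) lt_proj ly.
apply: le_trans (addr_ge0 x_vi l_vi) _.
rewrite le_eqVlt; apply/orP; left; apply/eqP.
rewrite Jop_skew /Hmat /Jop !opp_col_mx !add_col_mx mul_block_col !dot_col_mx.
(* Splitting 2 xt - xk as xt + (xt - xk) separates A xt - b, which belongs to J, from A (xt - xk),
   which belongs to H. *)
rewrite !col_mxKu !col_mxKd scaler_nat mulr2n -(addrA xt).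
move: (y - xt) (xt - xk) (l - lt) => e f g.
rewrite mulmxDr !mulmxDl mul_scalar_mx -!scalemxAl -mulmxA.
rewrite !(dotDr, dotNr, dotZr) !(dot_mulmxr A^T) trmxK.
rewrite !(dotDr, dotNr, dotZr) !(dotC _ (A *m e)).
by field; exact: lt0r_neq0.
Qed.

End VariationalInequality.

(** With a = w - ws and e = wt - w, the right side minus the left is exactly - 2 gamma (<a, H e> +
    <e, H e>), that is, 2 gamma times the quantity assumed nonnegative. *)
Lemma relaxation_contraction (R : realType) (d : nat) (H : 'M[R]_d)
    (w wt ws : 'cV[R]_d) (gamma : R) :
  posdef H -> 0 < gamma -> 0 <= dot (ws - wt) (H *m (wt - w)) ->
  let w' := w + gamma *: (wt - w) in
  norm_in H (w' - ws) ^+ 2 <=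
    norm_in H (w - ws) ^+ 2 - (2 - gamma) / gamma * norm_in H (w - w') ^+ 2.
Proof.
move=> Hpos gamma_gt0 h /=; rewrite !(norm_in_sqr Hpos) addrAC opprD addNKr.
have : 0 <= - dot (w - ws + (wt - w)) (H *m (wt - w)).
  by rewrite -dotNl [w - ws + _]addrC addrA subrK opprB.
move: (w - ws) (wt - w) => a e; rewrite mulmxN mulmxDr -!scalemxAr.
rewrite !(dotDl, dotDr, dotNl, dotNr, dotZl, dotZr) (posdefC Hpos e a) => {}h.
have : 0 <= 2 * gamma * (- (dot a (H *m e) + dot e (H *m e))).
  by rewrite mulr_ge0 // mulr_ge0 // ltW.
move=> h2; rewrite -subr_ge0; apply: le_trans h2 _.
rewrite le_eqVlt; apply/orP; left; apply/eqP; field; exact: lt0r_neq0.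
Qed.

(** * Limits of vectors along filters, and Fejer monotone sequences *)

Section Convergence.
Context {R : realType}.

(** The filter is arbitrary because limits are taken both along [\oo] and along a finer ultrafilter,
    which plays the role of a convergent subsequence. *)
Lemma cvg_col (T : Type) (F : set_system T) {FF : Filter F} (d : nat)
    (u : T -> 'cV[R]_d) (p : 'cV[R]_d) :
  (forall i, (fun k => u k i 0) @ F --> p i 0) -> u @ F --> p.
Proof.
move=> up; apply/cvg_ballP => e e0.
have : \forall k \near F, forall i, ball (p i 0) e (u k i 0).
  by apply: filter_forall => i; exact: (cvg_ball (up i)).
by apply: filterS => k h; split => // i j; rewrite ord1.
Qed.

Lemma cvg_coord (T : Type) (F : set_system T) {FF : Filter F} (d : nat)
    (u : T -> 'cV[R]_d) (p : 'cV[R]_d) i :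
  u @ F --> p -> (fun k => u k i 0) @ F --> p i 0.
Proof.
move=> up; apply: (@cvg_comp _ _ _ u (fun v : 'cV[R]_d => v i 0) _ _ _ up).
exact: coord_continuous.
Qed.

Lemma cvg_dot (T : Type) (F : set_system T) {FF : Filter F} (d : nat)
    (u v : T -> 'cV[R]_d) (p q : 'cV[R]_d) :
  u @ F --> p -> v @ F --> q -> (fun k => dot (u k) (v k)) @ F --> dot p q.
Proof.
move=> up vq; apply: cvg_big => [|i _]; first exact: add_continuous.
by apply: cvgM; exact: cvg_coord.
Qed.

Lemma cvg_mulmx (T : Type) (F : set_system T) {FF : Filter F} (m d : nat)
    (M : 'M[R]_(m, d)) (u : T -> 'cV[R]_d) (p : 'cV[R]_d) :
  u @ F --> p -> (fun k => M *m u k) @ F --> M *m p.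
Proof.
move=> up; apply: cvg_col => i; rewrite mxE.
under eq_fun do rewrite mxE.
apply: cvg_big => [|j _]; first exact: add_continuous.
by apply: cvgM; [exact: cvg_cst | exact: cvg_coord].
Qed.

Lemma cvg_usubmx (T : Type) (F : set_system T) {FF : Filter F} (m n : nat)
    (u : T -> 'cV[R]_(m + n)) (p : 'cV[R]_(m + n)) :
  u @ F --> p -> (fun k => usubmx (u k)) @ F --> usubmx p.
Proof.
move=> up; apply: cvg_col => i; rewrite mxE.
under eq_fun do rewrite mxE.
exact: cvg_coord.
Qed.

Lemma cvg_dsubmx (T : Type) (F : set_system T) {FF : Filter F} (m n : nat)
    (u : T -> 'cV[R]_(m + n)) (p : 'cV[R]_(m + n)) :
  u @ F --> p -> (fun k => dsubmx (u k)) @ F --> dsubmx p.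
Proof.
move=> up; apply: cvg_col => i; rewrite mxE.
under eq_fun do rewrite mxE.
exact: cvg_coord.
Qed.

Lemma posdef_cvg0 (T : Type) (F : set_system T) {FF : Filter F} (d : nat)
    (H : 'M[R]_d) (u : T -> 'cV[R]_d) :
  posdef H -> (fun k => dot (u k) (H *m u k)) @ F --> (0 : R) ->
  u @ F --> (0 : 'cV[R]_d).
Proof.
move=> /posdef_coord_le [C C0 uC] u0; apply: cvg_col => i; rewrite mxE.
apply/cvgr0Pnorm_lt => e e0.
have e2 : 0 < e ^+ 2 / C by rewrite divr_gt0 ?exprn_gt0.
near=> k; rewrite -(ltr_pXn2r (ltn0Sn 1)) ?nnegrE ?(ltW e0) //.
rewrite real_normK ?num_real //; apply: le_lt_trans (uC _ _) _.
by rewrite mulrC -ltr_pdivlMr //; near: k; exact: (cvgr_lt 0).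
Unshelve. all: by end_near. Qed.

(** Compactness of [-B, B] gives a cluster point. An ultrafilter converges to it: for each
    neighbourhood V, either the preimage of V is in [G], or that of its complement is, which
    contradicts clustering. *)
Lemma bounded_ultra_cvg (T : Type) (G : set_system T) {UG : UltraFilter G}
    (u : T -> R) (B : R) :
  (forall k, `|u k| <= B) -> exists p : R, u @ G --> p.
Proof.
move=> uB; have [|p [_ pcl]] := @segment_compact R (- B) B (u @ G) _.
  by apply: (@filterE T G) => k /=; rewrite in_itv /= -ler_norml.
exists p => V Vp.
have [//|GV] := in_ultra_setVsetC (u @^-1` V) UG.
by have [y []] := pcl (~` V) V GV Vp.
Qed.

(** Opial's argument. One ultrafilter serves all coordinates at once, so no successive extraction of
    subsequences occurs. *)
Lemma fejer_cvg (d : nat) (H : 'M[R]_d) (S : set 'cV[R]_d)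
    (w : nat -> 'cV[R]_d) :
  posdef H -> S !=set0 ->
  (forall s k, S s ->
     dot (w k.+1 - s) (H *m (w k.+1 - s)) <= dot (w k - s) (H *m (w k - s))) ->
  (forall (G : set_system nat) p, ProperFilter G -> \oo `<=` G ->
     w @ G --> p -> S p) ->
  exists2 p, S p & w @ \oo --> p.
Proof.
move=> Hpos [s Ss] fejer cluster_in.
have mono p k j : S p -> (k <= j)%N ->
    dot (w j - p) (H *m (w j - p)) <= dot (w k - p) (H *m (w k - p)).
  move=> Sp /subnK <-; elim: (j - k)%N => // i; apply: le_trans; exact: fejer.
have [G [UG oG]] := @ultraFilterLemma nat \oo _.
have [C C0 wC] := posdef_coord_le Hpos.
have cvgi i : exists p : R, (fun k => w k i 0) @ G --> p.
  pose D := C * dot (w 0%N - s) (H *m (w 0%N - s)).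
  (* The squared deviation of coordinate i from s is at most D <= (1 + D)^2, so 1 + D bounds the
     deviation itself. *)
  pose B := `|s i 0| + (1 + D).
  apply: (@bounded_ultra_cvg nat G UG (fun k => w k i 0) B) => k.
  rewrite -[w k i 0](subrK (s i 0)) addrC (le_trans (ler_normD _ _)) // lerD2l.
  have D0 : 0 <= D by rewrite mulr_ge0 ?posdef_ge0 // ltW.
  rewrite -(ler_pXn2r (ltn0Sn 1)) ?nnegrE ?addr_ge0 // real_normK ?num_real //.
  have := wC (w k - s) i; rewrite !mxE => /le_trans; apply.
  apply: (@le_trans _ _ D); last by rewrite expr2; nra.
  by rewrite ler_pM2l // mono.
have [f fcvg] := choice cvgi.
pose p : 'cV[R]_d := \col_i f i.
have wp : w @ G --> p by apply: cvg_col => i; rewrite mxE; exact: fcvg.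
have Sp : S p by exact: (cluster_in G).
exists p => //; suff : (fun k => w k - p) @ \oo --> (0 : 'cV[R]_d).
  move=> h; have : (fun k => w k - p + p) @ \oo --> 0 + p.
    by apply: cvgD => //; exact: cvg_cst.
  by rewrite add0r; under eq_fun do rewrite subrK.
apply: (posdef_cvg0 Hpos); apply/cvgr0Pnorm_lt => e e0.
have wp0 : (fun k => w k - p) @ G --> (0 : 'cV[R]_d).
  by rewrite -(subrr p); apply: cvgB => //; exact: cvg_cst.
have q0 : (fun k => dot (w k - p) (H *m (w k - p))) @ G --> dot 0 (H *m 0).
  by apply: cvg_dot => //; exact: cvg_mulmx.
rewrite mulmx0 dot0r in q0.
(* One index where the form is below e suffices: monotonicity keeps it below e from there on. *)
have [K qK] := filter_ex (cvgr_lt _ q0 _ e0).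
exists K => // k /= Kk; rewrite ger0_norm ?posdef_ge0 //.
by apply: le_lt_trans qK; exact: mono.
Qed.

End Convergence.

Lemma closed_multipliers (R : realType) (m : nat) (c : constraint) :
  closed (multipliers c : set 'cV[R]_m).
Proof.
case: c; first exact: closedT.
rewrite (_ : multipliers _ =
    \bigcap_i ((fun l : 'cV[R]_m => l i 0) @^-1` [set a | 0 <= a])); last first.
  by apply/seteqP; split => l /= h i; [move=> _ |]; exact: h.
apply: closed_bigI => i _; apply: closed_comp; last exact: closed_ge.
by move=> l _; exact: coord_continuous.
Qed.

(** * Contraction and convergence of P-rALM *)

Theorem theorem2p1 (R : realType) (m n : nat)
    (theta : 'cV[R]_n -> R) (X : set 'cV[R]_n) (c : constraint)
    (A : 'M[R]_(m, n)) (b : 'cV[R]_m) (gamma r : R) (Q : 'M[R]_n)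
    (x : nat -> 'cV[R]_n) (l : nat -> 'cV[R]_m)
    (theta_closed : lower_semicontinuous (fun u : 'cV[R]_n => (theta u)%:E))
    (theta_convex : @convex_function R 'cV[R]_n setT theta)
    (X_nonempty : X !=set0) (X_closed : closed X)
    (X_convex : @convex_set R 'cV[R]_n X)
    (solutions_nonempty : solutions theta X c A b !=set0)
    (r_gt0 : 0 < r) (Q_posdef : posdef Q)
    (gamma_gt0 : 0 < gamma) (gamma_lt2 : gamma < 2)
    (xl_generated : P_rALM theta X c A b gamma r Q x l) :
  let H := Hmat A r Q in
  let w := fun k : nat => col_mx (x k) (l k) in
  (forall (k : nat) (ws : 'cV[R]_(n + m)), solutions theta X c A b ws ->
     norm_in H (w k.+1 - ws) ^+ 2 <=
       norm_in H (w k - ws) ^+ 2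
       - (2 - gamma) / gamma * norm_in H (w k - w k.+1) ^+ 2) /\
  (exists winf : 'cV[R]_(n + m),
     solutions theta X c A b winf /\ w @ \oo --> winf).
Proof.
move=> H w; have Hpos : posdef H by exact: posdef_Hmat.
have [xt xt_spec] := choice xl_generated.
have [lt lt_spec] := choice xt_spec.
pose wt k := col_mx (xt k) (lt k).
have w_next k : w k.+1 = w k + gamma *: (wt k - w k).
  have [_ _ xS lS] := lt_spec k.
  by rewrite /w /wt xS lS opp_col_mx add_col_mx scale_col_mx add_col_mx.
have vi k v : primal_dual X c v ->
    0 <= theta (usubmx v) - theta (xt k) + dot (v - wt k) (Jop A b v)
      + dot (v - wt k) (H *m (wt k - w k)).
  have [xt_min lt_proj _ _] := lt_spec k.
  exact: (prediction_variational theta_convex X_convex r_gt0 Q_posdef xt_min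
    lt_proj).
have wt_feasible k : primal_dual X c (wt k).
  have [[Xxt _] [llt _] _ _] := lt_spec k.
  by rewrite /primal_dual /wt /= col_mxKu col_mxKd.
have contraction k ws : solutions theta X c A b ws ->
    norm_in H (w k.+1 - ws) ^+ 2 <= norm_in H (w k - ws) ^+ 2
      - (2 - gamma) / gamma * norm_in H (w k - w k.+1) ^+ 2.
  move=> [ws_feasible ws_opt]; rewrite w_next.
  apply: relaxation_contraction => //.
  (* [vi] evaluates J at its test point, here [ws], so on adding the two inequalities both the
     J-terms and the theta-terms cancel. *)
  have := vi k ws ws_feasible; have := ws_opt _ (wt_feasible k).
  rewrite col_mxKu -(opprB ws) dotNl; lra.
split=> //.
have kappa_gt0 : 0 < (2 - gamma) / gamma by rewrite divr_gt0 // subr_gt0.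
have step_cvg0 : (fun k => w k - w k.+1) @ \oo --> (0 : 'cV[R]_(n + m)).
  have [s s_sol] := solutions_nonempty.
  pose D k := norm_in H (w k - s) ^+ 2.
  have D_cvg : cvgn D.
    apply: nonincreasing_is_cvgn.
      apply/nonincreasing_seqP => k; apply: le_trans (contraction k s s_sol) _.
      by rewrite gerBl mulr_ge0 ?sqr_ge0 // ltW.
    by exists 0 => _ [k _ <-]; exact: sqr_ge0.
  apply: (posdef_cvg0 Hpos).
  (* The contraction bounds the squared step by [U k], which tends to 0 since [D] and its shift have
     the same limit. *)
  pose U k := ((2 - gamma) / gamma)^-1 * (D k - D k.+1).
  have U0 : U @ \oo --> (0 : R).
    rewrite -(mulr0 ((2 - gamma) / gamma)^-1) -(subrr (limn D)).
    apply: cvgM; first exact: cvg_cst.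
    by apply: cvgB => //; rewrite (cvg_shiftS D).
  apply: (@squeeze_cvgr _ \oo _ _ (fun=> 0) U) U0; last exact: cvg_cst.
  apply: nearW => k; rewrite posdef_ge0 //= /U mulrC ler_pdivlMr // mulrC.
  by have := contraction k s s_sol; rewrite -(norm_in_sqr Hpos) /D; lra.
suff [p] : exists2 p, solutions theta X c A b p & w @ \oo --> p by exists p.
apply: (fejer_cvg Hpos) => // [s k s_sol | G p GP oG wp].
  rewrite -!(norm_in_sqr Hpos); apply: le_trans (contraction k s s_sol) _.
  by rewrite gerBl mulr_ge0 ?sqr_ge0 // ltW.
have dw : (fun k => wt k - w k) @ G --> (0 : 'cV[R]_(n + m)).
  rewrite (_ : (fun k => _) = fun k => - gamma^-1 *: (w k - w k.+1)).
    rewrite -(scaler0 _ (- gamma^-1)); apply: cvgZr; apply: cvg_trans step_cvg0.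
    exact: cvg_app.
  apply/funext => k.
  rewrite w_next opprD addNKr scalerN scaleNr opprK scalerA.
  by rewrite mulVf ?scale1r ?lt0r_neq0.
have wtp : wt @ G --> p.
  have : (fun k => (wt k - w k) + w k) @ G --> 0 + p by exact: cvgD.
  by rewrite add0r; under eq_fun do rewrite subrK.
have xtp : xt @ G --> usubmx p.
  rewrite (_ : xt = fun k => usubmx (wt k)); first exact: cvg_usubmx.
  by apply/funext => k; rewrite col_mxKu.
have ltp : lt @ G --> dsubmx p.
  rewrite (_ : lt = fun k => dsubmx (wt k)); first exact: cvg_dsubmx.
  by apply/funext => k; rewrite col_mxKd.
split.
  split=> /=.
    apply: (closed_cvg X X_closed) xtp; apply: nearW => k.
    by have [[]] := lt_spec k.
  apply: (closed_cvg _ (@closed_multipliers R m c)) ltp; apply: nearW => k.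
  by have [_ []] := lt_spec k.
(* J is moved to the fixed point [v], matching the form of [vi] and staying constant in the
   limit. *)
move=> v v_feasible; rewrite -Jop_skew.
pose L k := theta (usubmx v) + (dot (v - wt k) (Jop A b v)
   + dot (v - wt k) (H *m (wt k - w k))).
have Lcvg : L @ G --> theta (usubmx v) + dot (v - p) (Jop A b v).
  rewrite -[dot (v - p) _]addr0 -(dot0r (v - p)) -(mulmx0 _ H).
  have vwt : (fun k => v - wt k) @ G --> v - p.
    by apply: cvgB => //; exact: cvg_cst.
  apply: cvgD; first exact: cvg_cst.
  apply: cvgD; apply: cvg_dot => //; first exact: cvg_cst.
  exact: cvg_mulmx.
rewrite leNgt; apply/negP => lt0.
set l0 := theta _ + dot _ _ in Lcvg.
(* If the inequality fails, l0 < theta at the limit, and [a] lies strictly between. For some k, L k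
   < a by convergence and a < theta (xt k) by lower semicontinuity, while [vi] says theta (xt k) <=
   L k. *)
pose a := (theta (usubmx p) + l0) / 2.
have l0a : l0 < a by rewrite /a /l0; lra.
have ap : (a%:E < (theta (usubmx p))%:E)%E by rewrite lte_fin /a /l0; lra.
have [V Vp aV] := theta_closed _ _ ap.
have [k [La Vk]] := filter_ex (filterI (cvgr_lt _ Lcvg _ l0a) (xtp V Vp)).
have := aV _ Vk; rewrite lte_fin => a_lt; have := vi k v v_feasible.
by move: La a_lt; rewrite /= /L; lra.
Qed.
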